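(* Let $(\Pi_{\sigma,\tau})_{0\le\sigma\le\tau}$ be a TCPP. The following conditions are equivalent: (i) The TCPP has No Multiperiod Free Lunch. (ii) The TCPP has No Static Free Lunch. (iii) There is a probability measure $R$ equivalent to $P$ with zero minimal penalty: $\alpha^m_{0,\infty}(R)=0$. (iv) There is a probability measure $R$ equivalent to $P$ such that for any stopping time $\sigma$, $$\forall X\in L^\infty(\Omega,\mathcal F_\infty,P),\qquad -\Pi_{\sigma,\infty}(-X)\le E_R(X|\mathcal F_\sigma)\le \Pi_{\sigma,\infty}(X).$$
   Context: Setting. $(\Omega,\mathcal F_\infty,(\mathcal F_t)_{t\in\mathbb R_+},P)$ is a filtered probability space; the filtration is right continuous and complete, and $\mathcal F_0$ is the $\sigma$-algebra generated by the $P$-null sets of $\mathcal F_\infty$. Stopping times take values in $[0,+\infty]$, and $\mathcal F_\tau=\{A\in\mathcal F_\infty : A\cap\{\tau\le t\}\in\mathcal F_t\ \forall t\in\mathbb R_+\}$. $L^\infty(\mathcal F_\tau)=L^\infty(\Omega,\mathcal F_\tau,P)$ (real valued classes); (in)equalities between elements hold $P$-a.s. A dynamic pricing procedure is a family of maps $\Pi_{\sigma,\tau}:L^\infty(\mathcal F_\tau)\to L^\infty(\mathcal F_\sigma)$, indexed by stopping times $0\le\sigma\le\tau$, such that for all $X,Y\in L^\infty(\mathcal F_\tau)$: monotonicity: $X\le Y\Rightarrow\Pi_{\sigma,\tau}(X)\le\Pi_{\sigma,\tau}(Y)$; translation invariance: $\Pi_{\sigma,\tau}(X+Z)=\Pi_{\sigma,\tau}(X)+Z$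 for all $Z\in L^\infty(\mathcal F_\sigma)$; convexity: $\Pi_{\sigma,\tau}(\lambda X+(1-\lambda)Y)\le\lambda\Pi_{\sigma,\tau}(X)+(1-\lambda)\Pi_{\sigma,\tau}(Y)$ for all $\lambda\in[0,1]$; normalization: $\Pi_{\sigma,\tau}(0)=0$. It is time-consistent if $\Pi_{\nu,\sigma}(\Pi_{\sigma,\tau}(X))=\Pi_{\nu,\tau}(X)$ for all stopping times $0\le\nu\le\sigma\le\tau$ and $X\in L^\infty(\mathcal F_\tau)$. It is continuous from below if for every increasing sequence $X_n$ in $L^\infty(\mathcal F_\tau)$ with limit $X\in L^\infty(\mathcal F_\tau)$, the increasing sequence $\Pi_{\sigma,\tau}(X_n)$ has limit $\Pi_{\sigma,\tau}(X)$. A TCPP is a time-consistent dynamic pricing procedure that is continuous from below. Minimal penalty. For a probability measure $R\ll P$, $\alpha^m_{\sigma,\tau}(R)=R\text{-}\mathrm{ess\,sup}_{X\in L^\infty(\Omega,\mathcal F_\tau,P)}\big(E_R(X|\mathcal F_\sigma)-\Pi_{\sigma,\tau}(X)\big)$. In particular $\alpha^m_{0,\infty}(R)=\sup_{X\in L^\infty(\mathcal F_\infty)}(E_R(X)-\Pi_{0,\infty}(X))$. No Static Free Lunch. Let $\mathcal C=\{\lambda X : \lambda\in\mathbb R_+,\ X\in L^\infty(\Omega,\mathcal F_\infty,P),\ \Pi_{0,\infty}(X)\le0\}$ and let $\overline{\mathcal C}$ be its closure in $L^\infty(\Omega,\mathcal F_\infty,P)$ for the weak* topology $\sigma(L^\infty(P),L^1(P))$.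 There is No Static Free Lunch if $\overline{\mathcal C}\cap L^\infty_+(\Omega,\mathcal F_\infty,P)=\{0\}$. No Multiperiod Free Lunch. Let $\mathcal K_0$ be the set of all $X=X_0+\sum_{1\le i\le n}(Z_i-Y_i)$, where $n$ is an integer, $0\le\tau_1\le\dots\le\tau_n<\infty$ are stopping times, $X_0,Y_i,Z_i\in L^\infty(\Omega,\mathcal F_\infty,P)$, $\Pi_{0,\infty}(X_0)\le0$, and $\Pi_{\tau_i,\infty}(Z_i)\le-\Pi_{\tau_i,\infty}(-Y_i)$ for all $1\le i\le n$. Let $\mathcal K=\{\lambda X:\lambda\in\mathbb R_+,\ X\in\mathcal K_0\}$ and $\overline{\mathcal K}$ its weak* closure. There is No Multiperiod Free Lunch if $\overline{\mathcal K}\cap L^\infty_+(\Omega,\mathcal F_\infty,P)=\{0\}$. *)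

(* Defs.v *)
From HB Require Import structures.
From mathcomp Require Import all_boot all_order all_algebra.
From mathcomp Require Import all_classical all_reals all_analysis.
From mathcomp Require Import measurable_realfun.

Set Implicit Arguments.
Unset Strict Implicit.
Unset Printing Implicit Defensive.

Import Order.TTheory GRing.Theory Num.Theory.
Import numFieldNormedType.Exports.

Local Open Scope classical_set_scope.
Local Open Scope ring_scope.

(* Throughout, the measurable sets of T are those of F_oo. *)

Section spaces.
Context {d : measure_display} {T : measurableType d} {R : realType}.
Variable P : probability T R.

(* Elements are functions; equality of classes is equality P-a.e. *)
Definition Linf := LfunType P (leey 1%E).
Definition L1 := LfunType P (lexx 1%E).

Definition Linf_on (G : set_system T) : set Linf :=
  [set X | forall B, measurable B -> G ((X : T -> R) @^-1` B)].

Definition Linf_ge0 : set Linf := [set X | \forall w \ae P, 0 <= X w].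

Definition Linf_zero : set Linf := [set X | \forall w \ae P, X w = 0].

(* sigma(Linf, L1) is the initial topology of X |-> (g |-> E_P[X g]), where
   R^L1 carries the topology of pointwise convergence. *)
Definition dual_pairing (X : Linf) : {ptws L1 -> R} :=
  fun g => (\int[P]_w (X w * g w))%R.

Definition weak_star_closure (A : set Linf) : set Linf :=
  @closure (initial_topology dual_pairing) A.

Definition cone_hull (A : set Linf) : set Linf :=
  [set l *: X | l in [set l : R | 0 <= l] & X in A].

End spaces.

Arguments Linf_on {d T R P} G.
Arguments Linf_ge0 {d T R} P.
Arguments Linf_zero {d T R} P.

Section filtrations.
Context {d : measure_display} {T : measurableType d} {R : realType}.

(* Only the F t with 0 <= t are relevant. *)
Record filtered_probability_space
    (P : probability T R) (F : R -> set_system T) : Prop := {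
  filtration_sigma_algebra :
    forall t, 0 <= t -> sigma_algebra [set: T] (F t) ;
  filtration_sub : forall t, 0 <= t -> F t `<=` measurable ;
  filtration_nondecreasing :
    forall s t, 0 <= s -> s <= t -> F s `<=` F t ;
  filtration_right_continuous :
    forall t, 0 <= t -> F t = \bigcap_(s in [set s | t < s]) F s ;
  filtration_complete_measure : measure_is_complete P ;
  filtration_complete : forall t, 0 <= t -> P.-negligible `<=` F t ;
  filtration_F0 : F 0 = <<s [set N | measurable N /\ P N = 0%E] >> }.

Variable F : R -> set_system T.

Definition stopping_time (tau : T -> \bar R) : Prop :=
  (forall w, 0 <= tau w)%E /\
  (forall t, 0 <= t -> F t [set w | (tau w <= t%:E)%E]).

Definition stopped_sigma_algebra (tau : T -> \bar R) : set_system T :=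
  [set A | measurable A /\
    forall t, 0 <= t -> F t (A `&` [set w | (tau w <= t%:E)%E])].

End filtrations.

Section conditional_expectation.
Context {d : measure_display} {T : measurableType d} {R : realType}.
Variable Q : probability T R.

Record is_cond_exp (G : set_system T) (X Y : T -> R) : Prop := {
  cond_exp_measurable : forall B, measurable B -> G (Y @^-1` B) ;
  cond_exp_integrable : Q.-integrable [set: T] (EFin \o Y) ;
  cond_exp_integral : forall A, G A ->
    (\int[Q]_(w in A) (Y w)%:E = \int[Q]_(w in A) (X w)%:E)%E }.

(* For integrable X and a sub-sigma-algebra G a version exists, so the default
   value is not reached. *)
Definition cond_exp (G : set_system T) (X : T -> R) : T -> R :=
  xget (cst 0) [set Y | is_cond_exp G X Y].

Record is_ess_sup (S : set (T -> R)) (a : T -> \bar R) : Prop := {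
  ess_sup_measurable : measurable_fun [set: T] a ;
  ess_sup_ub : forall f, S f -> \forall w \ae Q, ((f w)%:E <= a w)%E ;
  ess_sup_least : forall b : T -> \bar R, measurable_fun [set: T] b ->
    (forall f, S f -> \forall w \ae Q, ((f w)%:E <= b w)%E) ->
    \forall w \ae Q, (a w <= b w)%E }.

(* Likewise, a family of measurable functions has an essential supremum. *)
Definition family_ess_sup (S : set (T -> R)) : T -> \bar R :=
  xget (cst +oo%E) [set a | is_ess_sup S a].

End conditional_expectation.

Section pricing.
Context {d : measure_display} {T : measurableType d} {R : realType}.
Variable P : probability T R.

(* Monotonicity for the a.e. order makes p compatible with a.e. equality, so
   that p acts on classes. *)
Record pricing_map (G H : set_system T) (p : Linf P -> Linf P) : Prop := {
  pricing_range : forall X, Linf_on H X -> Linf_on G (p X) ;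
  pricing_monotone : forall X Y, Linf_on H X -> Linf_on H Y ->
    (\forall w \ae P, X w <= Y w) -> \forall w \ae P, p X w <= p Y w ;
  pricing_translation : forall X Z, Linf_on H X -> Linf_on G Z ->
    \forall w \ae P, p (X + Z) w = p X w + Z w ;
  pricing_convex : forall X Y l, Linf_on H X -> Linf_on H Y -> 0 <= l <= 1 ->
    \forall w \ae P,
      p (l *: X + (1 - l) *: Y) w <= l * p X w + (1 - l) * p Y w ;
  pricing_normalized : \forall w \ae P, p 0 w = 0 }.

Definition map_continuous_from_below (H : set_system T)
    (p : Linf P -> Linf P) : Prop :=
  forall (X_ : nat -> Linf P) (X : Linf P),
    (forall n, Linf_on H (X_ n)) -> Linf_on H X ->
    (forall n, \forall w \ae P, X_ n w <= X_ n.+1 w) ->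
    (\forall w \ae P, X_ n w @[n --> \oo] --> X w) ->
    \forall w \ae P, p (X_ n) w @[n --> \oo] --> p X w.

Variable F : R -> set_system T.

Local Notation "'F_[' tau ]" := (stopped_sigma_algebra F tau).

Variable Pi : (T -> \bar R) -> (T -> \bar R) -> Linf P -> Linf P.

Definition dynamic_pricing_procedure : Prop :=
  forall sigma tau, stopping_time F sigma -> stopping_time F tau ->
    (forall w, sigma w <= tau w)%E ->
    pricing_map F_[sigma] F_[tau] (Pi sigma tau).

Definition time_consistent : Prop :=
  forall nu sigma tau,
    stopping_time F nu -> stopping_time F sigma -> stopping_time F tau ->
    (forall w, nu w <= sigma w)%E -> (forall w, sigma w <= tau w)%E ->
    forall X, Linf_on F_[tau] X ->
      \forall w \ae P, Pi nu sigma (Pi sigma tau X) w = Pi nu tau X w.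

Definition continuous_from_below : Prop :=
  forall sigma tau, stopping_time F sigma -> stopping_time F tau ->
    (forall w, sigma w <= tau w)%E ->
    map_continuous_from_below F_[tau] (Pi sigma tau).

Definition TCPP : Prop :=
  [/\ dynamic_pricing_procedure, time_consistent & continuous_from_below].

Definition minimal_penalty (sigma tau : T -> \bar R) (Q : probability T R) :
    T -> \bar R :=
  family_ess_sup Q
    [set (fun w => cond_exp Q F_[sigma] X w - Pi sigma tau X w)
    | X in Linf_on F_[tau]].

Definition static_free_lunches : set (Linf P) :=
  cone_hull
    [set X : Linf P | \forall w \ae P, Pi (cst 0%E) (cst +oo%E) X w <= 0].

Definition no_static_free_lunch : Prop :=
  weak_star_closure static_free_lunches `&` Linf_ge0 P = Linf_zero P.

Definition multiperiod_portfolios : set (Linf P) :=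
  [set X : Linf P | exists (n : nat) (tau : 'I_n -> T -> \bar R)
      (X0 : Linf P) (Y Z : 'I_n -> Linf P),
    [/\ [/\ forall i, stopping_time F (tau i),
            forall i j : 'I_n, (i <= j)%N -> forall w, (tau i w <= tau j w)%E &
            forall i w, (tau i w < +oo)%E],
        \forall w \ae P, Pi (cst 0%E) (cst +oo%E) X0 w <= 0,
        forall i, \forall w \ae P,
          Pi (tau i) (cst +oo%E) (Z i) w <= - Pi (tau i) (cst +oo%E) (- Y i) w &
        X = X0 + \sum_(i < n) (Z i - Y i)]].

Definition no_multiperiod_free_lunch : Prop :=
  weak_star_closure (cone_hull multiperiod_portfolios) `&` Linf_ge0 P =
  Linf_zero P.

End pricing.

Definition equivalent_measure {d : measure_display} {T : measurableType d}
    {R : realType} (Q P : probability T R) : Prop :=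
  Q `<< P /\ P `<< Q.

(* Main.v *)
Require Import Defs.
From HB Require Import structures.
From mathcomp Require Import all_boot all_order all_algebra.
From mathcomp Require Import all_classical all_reals all_analysis.
From mathcomp Require Import measurable_realfun ess_sup_inf.
From mathcomp Require Import ring lra.

Set Implicit Arguments.
Unset Strict Implicit.
Unset Printing Implicit Defensive.

Import Order.TTheory GRing.Theory Num.Theory.
Import numFieldNormedType.Exports.

Local Open Scope classical_set_scope.
Local Open Scope ring_scope.

(** Everything goes through one intermediate condition on a probability Q
    equivalent to P, here called [supports]: E_Q X <= 0 for every claim X with
    Pi_{0,oo}(X) <= 0.

    Absence of static free lunches produces such a Q by a Kreps-Yan argument
    ([kreps_yan]).  The claims with Pi_{0,oo}(X) <= 0 span a convex cone C that
    contains every nonpositive claim.  If an indicator 1_A with P(A) > 0 is not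
    weak* adherent to C, finitely many functionals X |-> E(X g_i) already
    witness it, so that separating a point from a convex cone in R^n
    ([cone_separation]) gives g in L1 with E(X g) <= 0 on C and E(1_A g) > 0.
    Such a g is nonnegative.  Countable sums of them ([polar_cone_countable])
    yield one whose support has maximal probability; the separation, applied to
    the complement A of that support, shows that it is positive a.s.
    Normalized, it is the density of Q.

    A supporting Q is consistent with the prices at every stopping time sigma
    ([supports_cond_exp_le]).  Otherwise A = {Pi_sigma(X) < E_Q(X | F_sigma)}
    is not negligible; it belongs to F_sigma.  The claim
    W = 1_A (X - Pi_sigma(X)) has Pi_sigma(W) <= 0: this is a local form of
    translation invariance ([pricing_local]).  By time consistency
    Pi_{0,oo}(W) <= 0, hence E_Q(W) <= 0, whereas
    E_Q(W) = E_Q(1_A (E_Q(X | F_sigma) - Pi_sigma(X))) > 0.  For sigma = 0 this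
    bound says that the minimal penalty, attained at X = 0, vanishes
    ([supports_minimal_penalty]); the converse is
    [minimal_penalty_supports].

    Finally, if Q is consistent with the prices at every stopping time, each
    trade of a multiperiod portfolio has nonpositive Q-expectation.  With h the
    density of Q, the half-space E(X h) <= 0 is weak* closed and thus contains
    the closure of the cone of portfolios; a nonnegative claim in it is zero
    ([consistent_measure_no_free_lunch]).  Static free lunches are the
    multiperiod ones without trades, which closes the cycle. *)

(** * Separation of a point from a convex cone in R^n *)

Lemma closure_sub_closed (U : topologicalType) (A B : set U) :
  A `<=` B -> closed B -> closure A `<=` B.
Proof. by move=> AB /closure_id ->; exact: closureS. Qed.

Section finite_dim_separation.
Context {R : realType} {n : nat}.
Implicit Types x y v : 'rV[R]_n.

Definition dotr x y : R := \sum_i x ord0 i * y ord0 i.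

Lemma dotrDr x y z : dotr x (y + z) = dotr x y + dotr x z.
Proof.
by rewrite -big_split; apply: eq_bigr => i _; rewrite mxE mulrDr.
Qed.

Lemma dotrZr x y a : dotr x (a *: y) = a * dotr x y.
Proof. by rewrite mulr_sumr; apply: eq_bigr => i _; rewrite mxE mulrCA. Qed.

Lemma dotrC x y : dotr x y = dotr y x.
Proof. by apply: eq_bigr => i _; rewrite mulrC. Qed.

Lemma dotr_ge0 x : 0 <= dotr x x.
Proof. by apply: sumr_ge0 => i _; exact: sqr_ge0. Qed.

Lemma dotr_sqrD x y : dotr (x + y) (x + y) = dotr x x + 2 * dotr x y + dotr y y.
Proof.
rewrite !dotrDr dotrC dotrDr [dotr (x + y) y]dotrC dotrDr (dotrC y x).
by ring.
Qed.

Lemma continuous_dotr_sub v :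
  continuous (fun x : 'rV[R]_n => dotr (v - x) (v - x)).
Proof.
move=> x; rewrite /dotr.
have addc : continuous (fun z : R^o * R^o => z.1 + z.2).
  by move=> z; exact: add_continuous.
apply: (cvg_big addc (nbhs_filter x)) => i _.
under eq_fun do rewrite !mxE; rewrite !mxE.
by apply: cvgM; apply: cvgB; [exact: cvg_cst|exact: coord_continuous|
  exact: cvg_cst|exact: coord_continuous].
Qed.

(** A closest point p to v exists in the closure of K, because closed bounded
    sets of R^n are compact, and c := v - p is normal to K at p: moving p along a
    direction that stays in the closure cannot decrease the distance to v. *)
Lemma cone_separation (K : set 'rV[R]_n) v (e : R) :
    K 0 -> (forall x y, K x -> K y -> K (x + y)) ->
    (forall t x, 0 <= t -> K x -> K (t *: x)) ->
    0 < e -> (forall x, K x -> e <= dotr (v - x) (v - x)) ->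
  exists c, (forall x, K x -> dotr c x <= 0) /\ 0 < dotr c v.
Proof.
move=> K0 KD KZ e0 Kfar.
pose f x := dotr (v - x) (v - x).
have cf : continuous f by exact: continuous_dotr_sub.
have clKD x y : closure K x -> K y -> closure K (x + y).
  move=> + Ky; apply: (@closure_sub_closed _ _ ((+%R^~ y) @^-1` closure K)).
    by move=> z Kz; exact: subset_closure (KD _ _ Kz Ky).
  apply: preimage_closed; last exact: closed_closure.
  move=> z _; apply: (@continuousD _ _ _ id (cst y)); first by move=> B.
  exact: cst_continuous.
have clKZ t x : 0 <= t -> closure K x -> closure K (t *: x).
  move=> t0.
  apply: (@closure_sub_closed _ _ ((GRing.scale t) @^-1` closure K)).
    by move=> z Kz; exact: subset_closure (KZ _ _ t0 Kz).
  apply: preimage_closed; last exact: closed_closure.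
  by move=> z _; exact: scaler_continuous.
have clKfar x : closure K x -> e <= f x.
  apply: (@closure_sub_closed _ _ (f @^-1` [set r | e <= r])) => //.
  by apply: preimage_closed; [move=> z _; exact: cf|exact: closed_ge].
(* Points farther from v than 0 is cannot minimize the distance, which leaves
   a compact set. *)
have [p Kp pmin] : exists2 p, closure K p & forall x, closure K x -> f p <= f x.
  pose A := closure K `&` [set x | f x <= f 0].
  have A0 : A 0 by split; [exact: subset_closure|exact: lexx].
  have cA : compact A.
    apply: bounded_closed_compact; last first.
      apply: closedI; first exact: closed_closure.
      apply: (@preimage_closed _ _ f [set r | r <= f 0]); last exact: closed_le.
      by move=> z _; exact: cf.
    exists (`|v| + (f 0 + 1)); split; first exact: num_real.
    move=> M /ltW Mgt x [_ /= fx]; apply: le_trans Mgt.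
    have -> : x = v - (v - x) by rewrite opprB addrC subrK.
    apply: le_trans (ler_normB _ _) _; rewrite lerD2l.
    rewrite [leLHS]/Num.norm /= mx_normrE.
    apply: bigmax_le => [|[i j] _ /=].
      by rewrite addr_ge0// dotr_ge0.
    have h : (v - x) i j ^+ 2 <= f 0.
      apply: le_trans fx; rewrite /f /dotr (bigD1 j)//= (ord1 i) -expr2 lerDl.
      by apply: sumr_ge0 => k _; rewrite -expr2 sqr_ge0.
    have [h1|h1] := leP `|(v - x) i j| 1.
      by apply: le_trans h1 _; rewrite lerDr dotr_ge0.
    apply: (@le_trans _ _ (f 0)); last by rewrite lerDl.
    apply: le_trans h; rewrite -normr_id -real_normK ?num_real// normr_id.
    by rewrite expr2 ler_peMl// ltW.
  have [p pA pmin] := compact_EVT_min (ex_intro _ 0 A0) cA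
    (@continuous_subspaceT _ _ A _ cf).
  move: pA; rewrite inE => -[Kp fp0].
  exists p => // x Kx; have [h|/ltW h] := leP (f x) (f 0).
    by apply: pmin; rewrite inE.
  by apply: le_trans h.
pose c := v - p.
(* First-order optimality of p: compare the distance at p and at p + t x and let
   t tend to 0. *)
have var x : (forall t, 0 < t < 1 -> closure K (p + t *: x)) -> dotr c x <= 0.
  move=> Kt.
  have h t : 0 < t < 1 -> 2 * dotr c x <= t * dotr x x.
    move=> /andP[t0 t1].
    have : f p <= f (p + t *: x) by apply: pmin; apply: Kt; rewrite t0.
    rewrite /f opprD addrA -scaleNr (dotr_sqrD (v - p)) -/c !dotrZr.
    rewrite [dotr (_ *: _) x]dotrC dotrZr -addrA lerDl => h.
    rewrite -(ler_pM2l t0); lra.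
  rewrite leNgt; apply/negP => c0.
  have d0 := dotr_ge0 x.
  have := h (dotr c x / (dotr c x + dotr x x + dotr c x)).
  have s0 : 0 < dotr c x + dotr x x + dotr c x by lra.
  rewrite divr_gt0//= ltr_pdivrMr// mul1r => /(_ ltac:(lra)).
  rewrite -mulrA -(@ler_pM2r _ (dotr c x + dotr x x + dotr c x))//.
  rewrite -!mulrA (mulrC _^-1) -mulrA mulfV ?gt_eqF// mulr1.
  rewrite [2 * _]mulrC -mulrA ler_pM2l//; lra.
exists c; split.
  by move=> x Kx; apply: var => t /andP[t0 _]; apply: clKD => //;
    apply: KZ => //; exact: ltW.
(* The direction - p is admissible because p + t (- p) = (1 - t) p. *)
have : dotr c (- p) <= 0.
  apply: var => t /andP[t0 t1]; have -> : p + t *: (- p) = (1 - t) *: p.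
    by rewrite scalerN scalerBl scale1r.
  by apply: clKZ => //; rewrite subr_ge0 ltW.
rewrite -scaleN1r dotrZr mulN1r oppr_le0 => cp.
have -> : v = c + p by rewrite /c subrK.
by rewrite dotrDr ltr_wpDr// (lt_le_trans e0)// clKfar.
Qed.

End finite_dim_separation.

(** * Weak* closure *)

Section weak_star.
Context {d : measure_display} {T : measurableType d} {R : realType}.
Variable P : probability T R.

Lemma cvg_initial_topology (S : choiceType) (U : topologicalType) (f : S -> U)
    (F : set_system S) (s : S) :
  Filter F -> f @ F --> f s -> F --> (s : initial_topology f).
Proof.
move=> FF fFs A [_ [[B oB <-] /= Bfs BA]].
by apply: filterS BA _; apply: fFs; exact: open_nbhs_nbhs.
Qed.

Lemma continuous_dual_pairing (g : L1 P) :
  continuous (fun X : initial_topology (@dual_pairing _ _ _ P) => dual_pairing X g).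
Proof.
move=> X; apply: (@continuous_comp _ _ _
  (@dual_pairing _ _ _ P : initial_topology (@dual_pairing _ _ _ P) -> _)
  (fun h : {ptws L1 P -> R} => h g)).
  exact: initial_continuous.
exact: (@proj_continuous (L1 P) (fun=> R) g).
Qed.

Lemma weak_star_closure_halfspace (A : set (Linf P)) (g : L1 P) :
  (forall X, A X -> dual_pairing X g <= 0) ->
  forall X, weak_star_closure A X -> dual_pairing X g <= 0.
Proof.
move=> Ag.
apply: (@closure_sub_closed (initial_topology (@dual_pairing _ _ _ P)) _
   [set X | dual_pairing X g <= 0]) => //.
apply: (@preimage_closed _ _ (fun X : initial_topology (@dual_pairing _ _ _ P)
   => dual_pairing X g) [set r | r <= 0]); last exact: closed_le.
by move=> X _; exact: continuous_dual_pairing.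
Qed.

(** A point outside the closure is missed by a basic neighbourhood, which only
    involves finitely many functionals.  The contrapositive is proved: the traces
    on A of the basic neighbourhoods of X generate a filter converging to X. *)
Lemma not_weak_star_closure (A : set (Linf P)) (X : Linf P) :
  ~ weak_star_closure A X ->
  exists (s : seq (L1 P)) (e : R), 0 < e /\ forall Y, A Y ->
    exists2 g, g \in s & e <= `|dual_pairing X g - dual_pairing Y g|.
Proof.
apply: contra_notP => nse.
pose B (k : seq (L1 P) * {posnum R}) := A `&` [set Y | forall g, g \in k.1 ->
  `|dual_pairing X g - dual_pairing Y g| < k.2%:num].
have FF : Filter (filter_from setT B).
  apply: filter_from_filter; first by exists ([::], PosNum ltr01).
  move=> [s1 e1] [s2 e2] _ _.
  exists (s1 ++ s2, Num.min e1 e2) => // Y [AY /= h].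
  split; split => //= g gs; apply: lt_le_trans (h g _) _.
  - by rewrite mem_cat gs.
  - by rewrite num_le ge_min lexx.
  - by rewrite mem_cat gs orbT.
  - by rewrite num_le ge_min lexx orbT.
have PF : ProperFilter (filter_from setT B).
  apply: filter_from_proper => -[s e] _; apply: contrapT => BN.
  apply: nse; exists s, e%:num; split => // Y AY.
  apply: contrapT => H; apply: BN; exists Y; split => //= g gs.
  by rewrite ltNge; apply/negP => ?; apply: H; exists g.
rewrite /weak_star_closure closureEcvg; exists (filter_from setT B) => //.
split.
  apply: (@cvg_initial_topology (Linf P) _ (@dual_pairing _ _ _ P)).
  apply/cvg_sup => g.
  apply: (@cvg_initial_topology _ R (fun h : L1 P -> R => h g)).
  rewrite -fmap_comp; apply/cvgrPdist_lt => e e0.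
  exists ([:: g], PosNum e0) => // Y [_ /= /(_ g)]; apply.
  by rewrite inE.
by move=> C sAC; exists ([::], PosNum ltr01) => // Y [AY _]; exact: sAC.
Qed.

End weak_star.

(** * Integrals, bounded functions and integrable functions *)

Section real_integrals.
Context {d : measure_display} {T : measurableType d} {R : realType}.
Variable mu : {measure set T -> \bar R}.
Implicit Types f g : T -> R.

Lemma integrable_ae_boundedM (M : R) f g : measurable_fun setT f ->
  (\forall w \ae mu, `|f w| <= M) -> mu.-integrable setT (EFin \o g) ->
  mu.-integrable setT (EFin \o (fun w => f w * g w)).
Proof.
move=> mf fM ig; have mg := measurable_int _ ig.
have /integrableP[mMg Mgoo] := integrableZl measurableT M ig.
have mfg : measurable_fun setT (EFin \o (fun w => f w * g w)).
  by apply/measurable_EFinP/measurable_funM => //; exact/measurable_EFinP.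
apply/integrableP; split => //; apply: le_lt_trans Mgoo.
apply: ae_ge0_le_integral => //.
- exact: measurableT_comp.
- exact: measurableT_comp.
- apply: filterS fM => w fM _ /=.
  by rewrite lee_fin !normrM ler_wpM2r// (le_trans fM)// ler_norm.
Qed.

Lemma ae_ge0_Rintegral f : mu.-integrable setT (EFin \o f) ->
  (\forall w \ae mu, 0 <= f w) -> (\int[mu]_w `|f w| = \int[mu]_w f w)%R.
Proof.
move=> /measurable_int mf f0; congr fine; apply: ae_eq_integral => //.
  apply: measurableT_comp => //; apply: measurableT_comp => //.
  exact/measurable_EFinP.
by apply: filterS f0 => w f0 _; rewrite ger0_norm.
Qed.

Lemma ae_le_Rintegral f g : mu.-integrable setT (EFin \o f) ->
  mu.-integrable setT (EFin \o g) ->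
  (\forall w \ae mu, f w <= g w) -> \int[mu]_w f w <= \int[mu]_w g w.
Proof.
move=> fi gi fg; rewrite -subr_ge0 -RintegralB// -ae_ge0_Rintegral.
- by apply: Rintegral_ge0.
- exact: (integrableB measurableT gi fi).
- by apply: filterS fg => w; rewrite subr_ge0.
Qed.

Lemma Rintegral_le0_ae_eq0 f : mu.-integrable setT (EFin \o f) ->
  (\forall w \ae mu, 0 <= f w) -> \int[mu]_w f w <= 0 ->
  \forall w \ae mu, f w = 0.
Proof.
move=> fi f0; rewrite -ae_ge0_Rintegral// => If.
have mf := measurable_int _ fi.
have If0 : (\int[mu]_w `|(EFin \o f) w|)%E = 0%E.
  have fin : (\int[mu]_w `|(EFin \o f) w|)%E \is a fin_num.
    exact: integrable_fin_num (integrable_abse fi).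
  apply/eqP; rewrite -(fineK fin) eqe eq_le; apply/andP; split; first exact: If.
  by apply: fine_ge0; exact: integral_ge0.
have /(_ If0) h := (ae_eq_integral_abs mu measurableT mf).1.
by apply: filterS h => w /(_ I) [].
Qed.

Lemma ae_eq_Rintegral f g : measurable_fun setT f -> measurable_fun setT g ->
  (\forall w \ae mu, f w = g w) -> \int[mu]_w f w = \int[mu]_w g w.
Proof.
move=> mf mg fg; congr fine; apply: ae_eq_integral => //;
  try exact/measurable_EFinP.
by apply: filterS fg => w /= ->.
Qed.

End real_integrals.

Lemma le_measure_ae {d : measure_display} {T : measurableType d} {R : realType}
    (mu : {measure set T -> \bar R}) (A B : set T) :
  measurable A -> measurable B -> (\forall w \ae mu, A w -> B w) ->
  (mu A <= mu B)%E.
Proof.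
move=> mA mB [N [mN N0 ABN]].
apply: (@le_trans _ _ (mu (B `|` N))); last first.
  by rewrite -[leRHS]adde0 -N0; exact: measureU2.
rewrite le_measure ?inE//; first exact: measurableU.
move=> w Aw; have [Bw|nBw] := pselect (B w); first by left.
by right; apply: ABN => /= /(_ Aw).
Qed.

Lemma dominates_ae {d : measure_display} {T : measurableType d} {R : realType}
    (Q P : probability T R) (p : T -> Prop) :
  Q `<< P -> (\forall w \ae P, p w) -> \forall w \ae Q, p w.
Proof.
move=> /null_content_dominatesP QP [N [mN PN pN]].
by exists N; split => //; exact: QP.
Qed.

Section Lfunctions.
Context {d : measure_display} {T : measurableType d} {R : realType}.
Variable P : probability T R.

Lemma Linf_ae_bounded (X : Linf P) :
  exists M, 0 <= M /\ \forall w \ae P, `|X w| <= M.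
Proof.
have := @Lfunction_finite _ _ _ P _ _ X; rewrite /finite_norm unlock /=.
rewrite [P setT]probability_setT lte01 => eX.
have Xle := ess_sup_ge P (abse \o (EFin \o X)).
case: (ess_sup P (abse \o (EFin \o X))) eX Xle => [r| |]// _ Xle.
  exists (Num.max 0 r); split; first by rewrite le_max lexx.
  by apply: filterS Xle => w; rewrite /= lee_fin le_max orbC => ->.
by exists 0; split => //; apply: filterS Xle.
Qed.

Lemma Linf_of_ae_bounded (f : T -> R) (M : R) : measurable_fun setT f ->
  (\forall w \ae P, `|f w| <= M) -> exists X : Linf P, X = f :> (T -> R).
Proof.
move=> mf fM; have Pf : f \in Lfun P +oo.
  rewrite inE; apply/andP; split; first by rewrite inE.
  rewrite inE /= /finite_norm unlock /= [P setT]probability_setT lte01.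
  apply: (@le_lt_trans _ _ M%:E); last exact: ltry.
  by apply/ess_supP; apply: filterS fM => w /=; rewrite lee_fin.
by exists (Lfun_Sub (leey 1%E) Pf).
Qed.

Lemma L1_of_integrable (f : T -> R) : P.-integrable setT (EFin \o f) ->
  exists g : L1 P, g = f :> (T -> R).
Proof. by move=> /Lfun1_integrable Pf; exists (Lfun_Sub (lexx 1%E) Pf). Qed.

Lemma L1_integrable (g : L1 P) : P.-integrable setT (EFin \o g).
Proof. by apply/Lfun1_integrable; exact: LfunP. Qed.

Lemma Linf_integrable (Q : probability T R) (X : Linf P) :
  Q `<< P -> Q.-integrable setT (EFin \o X).
Proof.
move=> QP; have [M [_ XM]] := Linf_ae_bounded X.
have := @integrable_ae_boundedM _ _ _ Q M X (cst 1) _ (dominates_ae QP XM) _.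
rewrite (_ : EFin \o (fun w => X w * cst 1 w) = EFin \o X); last first.
  by apply/funext => w /=; rewrite mulr1.
by apply => //; exact: finite_measure_integrable_cst.
Qed.

Lemma dual_pairing_integrable (X : Linf P) (g : L1 P) :
  P.-integrable setT (EFin \o (fun w => X w * g w)).
Proof.
have [M [_ XM]] := Linf_ae_bounded X.
by apply: (integrable_ae_boundedM _ XM) => //; exact: L1_integrable.
Qed.

Lemma dual_pairingDr (X : Linf P) (g h : L1 P) :
  dual_pairing X (g + h) = dual_pairing X g + dual_pairing X h.
Proof.
rewrite /dual_pairing -RintegralD//; try exact: dual_pairing_integrable.
by apply: eq_Rintegral => w _ /=; rewrite mulrDr.
Qed.

Lemma dual_pairingZr (X : Linf P) (a : R) (g : L1 P) :
  dual_pairing X (a *: g) = a * dual_pairing X g.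
Proof.
rewrite /dual_pairing -RintegralZl//; last exact: dual_pairing_integrable.
by apply: eq_Rintegral => w _ /=; rewrite mulrCA.
Qed.

Lemma dual_pairingDl (X Y : Linf P) (g : L1 P) :
  dual_pairing (X + Y) g = dual_pairing X g + dual_pairing Y g.
Proof.
rewrite /dual_pairing -RintegralD//; try exact: dual_pairing_integrable.
by apply: eq_Rintegral => w _ /=; rewrite mulrDl.
Qed.

Lemma dual_pairingZl (X : Linf P) (a : R) (g : L1 P) :
  dual_pairing (a *: X) g = a * dual_pairing X g.
Proof.
rewrite /dual_pairing -RintegralZl//; last exact: dual_pairing_integrable.
by apply: eq_Rintegral => w _ /=; rewrite mulrA.
Qed.

End Lfunctions.

(** * The Kreps-Yan theorem *)

Section kreps_yan.
Context {d : measure_display} {T : measurableType d} {R : realType}.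
Variable P : probability T R.

Definition polar_cone (C : set (Linf P)) : set (L1 P) :=
  [set g | forall X, C X -> dual_pairing X g <= 0].

Lemma dual_pairing_sumr (I : Type) (r : seq I) (c : I -> R) (g : I -> L1 P) X :
  dual_pairing X (\sum_(i <- r) c i *: g i) =
  \sum_(i <- r) c i * dual_pairing X (g i).
Proof.
elim: r => [|i r IH]; last by rewrite !big_cons dual_pairingDr dual_pairingZr IH.
by rewrite !big_nil -(scale0r 0) dual_pairingZr mul0r.
Qed.

Section convex_cone.
Variable C : set (Linf P).
Hypothesis CD : forall X Y, C X -> C Y -> C (X + Y).
Hypothesis CZ : forall l X, 0 <= l -> C X -> C (l *: X).

(** By [not_weak_star_closure] the position of X relative to C is decided by
    finitely many functionals; C and X are mapped by these to R^n, where
    [cone_separation] provides the coefficients of g. *)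
Lemma polar_cone_separates (X : Linf P) : C 0 -> ~ weak_star_closure C X ->
  exists2 g, polar_cone C g & 0 < dual_pairing X g.
Proof.
move=> C0 /not_weak_star_closure [s [e [e0 far]]].
pose g (i : 'I_(size s)) := tnth (in_tuple s) i.
pose phi (Y : Linf P) := \row_i dual_pairing Y (g i).
have phiD Y Z : phi (Y + Z) = phi Y + phi Z.
  by apply/rowP => i; rewrite !mxE dual_pairingDl.
have phiZ a Y : phi (a *: Y) = a *: phi Y.
  by apply/rowP => i; rewrite !mxE dual_pairingZl.
have [||||_ [Y CY <-]|c [cK cX]] :=
    @cone_separation _ _ (phi @` C) (phi X) (e ^+ 2) _ _ _ _ _.
- by exists 0 => //; apply/rowP => i; rewrite -(scale0r 0) phiZ !mxE mul0r.
- by move=> _ _ [Y CY <-] [Z CZ' <-]; exists (Y + Z) => //; exact: CD.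
- by move=> t _ t0 [Y CY <-]; exists (t *: Y) => //; exact: CZ.
- by rewrite exprn_gt0.
- have [h /seq_tnthP[i ->] eh] := far Y CY.
  rewrite /dotr (bigD1 i)//= !mxE -expr2 -[leLHS]addr0 lerD//.
    rewrite -[leRHS]real_normK ?num_real// ler_pXn2r// ?nnegrE// ltW//.
  by apply: sumr_ge0 => k _; rewrite -expr2 sqr_ge0.
have phig Y : dotr c (phi Y) = dual_pairing Y (\sum_i c ord0 i *: g i).
  by rewrite dual_pairing_sumr; apply: eq_bigr => i _; rewrite mxE.
exists (\sum_i c ord0 i *: g i); last by rewrite -phig.
by move=> Y CY; rewrite -phig; apply: cK; exists Y.
Qed.

Hypothesis Cneg : forall X : Linf P, (\forall w \ae P, X w <= 0) -> C X.

(** Test g against the nonpositive function - 1_{g < 0}. *)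
Lemma polar_cone_ge0 g : polar_cone C g -> \forall w \ae P, 0 <= g w.
Proof.
move=> Cg; pose A := [set w | g w < 0].
have mA : measurable A.
  rewrite -[A]setTI; apply: (@measurable_fun_ltr _ _ _ setT g (cst 0)) => //.
have [X XE] : exists X : Linf P, X = (fun w => - \1_A w) :> (T -> R).
  apply: (@Linf_of_ae_bounded _ _ _ P _ 1); first by apply: measurableT_comp.
  apply: aeW => w; rewrite normrN indicE.
  by case: (_ \in _); rewrite ?normr1 ?normr0.
have CX : C X by apply: Cneg; apply: aeW => w; rewrite XE oppr_le0 indicE.
have Xg w : 0 <= X w * g w.
  rewrite XE indicE; have [|] := boolP (w \in A).
    by rewrite inE /A/= => gw; rewrite mulN1r oppr_ge0 ltW.
  by rewrite oppr0 mul0r.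
have := Rintegral_le0_ae_eq0 (dual_pairing_integrable X g) (aeW _ Xg) (Cg X CX).
apply: filterS => w; rewrite XE indicE leNgt => Xg0; apply/negP => gw.
move: Xg0; rewrite (_ : w \in A); last by rewrite inE.
by rewrite mulN1r => /eqP; rewrite oppr_eq0 lt_eqF.
Qed.

Lemma polar_coneD g h : polar_cone C g -> polar_cone C h -> polar_cone C (g + h).
Proof.
by move=> Cg Ch X CX; rewrite dual_pairingDr -[leRHS]addr0 lerD ?Cg ?Ch.
Qed.

(** A sum of the g_n with weights c_n > 0 such that the sum of the c_n ||g_n||_1
    is finite is integrable, and a.s. positive wherever some g_n is.  To pass
    E(X .) <= 0 to the sum although X has no sign, add a constant M bounding |X|:
    then E((X + M) g_n) <= M E(g_n) involves nonnegative terms only and can be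
    summed. *)
Lemma polar_cone_countable (g_ : nat -> L1 P) : (forall n, polar_cone C (g_ n)) ->
  exists2 g, polar_cone C g & forall n, \forall w \ae P, 0 < g_ n w -> 0 < g w.
Proof.
move=> Cg.
pose I n := \int[P]_w `|g_ n w|.
have I0 n : 0 <= I n by exact: Rintegral_ge0.
pose c n : R := 1 / (2 ^ (n + 1))%:R / (1 + I n).
have c0 n : 0 < c n by rewrite divr_gt0 ?divr_gt0 ?ltr0n ?expn_gt0// ltr_pwDl.
have mg n : measurable_fun setT (g_ n) by [].
have mng n : measurable_fun setT (fun w => `|g_ n w|).
  exact: measurableT_comp.
pose b n w : \bar R := (c n * `|g_ n w|)%:E.
have mb n : measurable_fun setT (b n).
  by apply/measurable_EFinP; exact: measurable_funM.
have b0 n w : (0 <= b n w)%E by rewrite lee_fin mulr_ge0// ltW.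
pose G w := (\sum_(0 <= n <oo) b n w)%E.
have G0 w : (0 <= G w)%E by exact: nneseries_ge0.
have mG : measurable_fun setT G by exact: ge0_emeasurable_sum.
have ing n : P.-integrable setT (EFin \o (fun w => `|g_ n w|)).
  exact: (integrable_abse (L1_integrable (g_ n))).
have intb n : (\int[P]_w b n w = (c n * I n)%:E)%E.
  rewrite /b; under eq_integral do rewrite EFinM.
  rewrite integralZl//; last exact: ing.
  rewrite [RHS]EFinM; congr (_ * _)%E.
  rewrite /I /Rintegral fineK//.
  exact: (integrable_fin_num measurableT (ing n)).
have intG : (\int[P]_w G w = \sum_(0 <= n <oo) (c n * I n)%:E)%E.
  by rewrite integral_nneseries//; apply: eq_eseriesr => n _.
have intGoo : (\int[P]_w G w < +oo)%E.
  rewrite intG; apply: (@le_lt_trans _ _ 1%E); last exact: ltry.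
  have half : (\sum_(0 <= n <oo) (1 / (2 ^ (n + 1))%:R : R)%:E)%E = 1%E.
    have /cvg_lim : eseries (fun k => (1 / (2 ^ (k + 1))%:R : R)%:E) @ \oo --> 1%E.
      by have := @cvg_geometric_eseries_half R 1 0; rewrite expr0 divr1.
    exact.
  rewrite -half; apply: lee_nneseries => [n _ _|n _].
    by rewrite lee_fin mulr_ge0// ltW.
  rewrite lee_fin /c !mul1r -mulrA ler_piMr// ?divr_ge0//.
  by rewrite mulrC ler_pdivrMr ?mul1r ?lerDr// ltr_pwDl.
have iG : P.-integrable setT G.
  by apply/integrableP; split => //; under eq_integral do rewrite gee0_abs//.
have Gfin : \forall w \ae P, (fine (G w))%:E = G w.
  by apply: filterS (integrable_ae measurableT iG) => w /(_ Logic.I) /fineK.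
have mfG : measurable_fun setT (fine \o G) by exact: measurableT_comp.
have ifG : P.-integrable setT (EFin \o (fine \o G)).
  apply/integrableP; split; first exact/measurable_EFinP.
  apply: le_lt_trans intGoo; apply: ae_ge0_le_integral => //.
    by apply: measurableT_comp => //; exact/measurable_EFinP.
  apply: filterS Gfin => w Gw _.
  by rewrite -[leRHS]Gw /= lee_fin ger0_norm // fine_ge0.
have [g gE] := L1_of_integrable ifG.
exists g; last first.
  move=> n; apply: filterS Gfin => w Gw gn; rewrite gE /= -lte_fin Gw /G.
  rewrite (nneseriesD1 (n := n))//; apply: lt_le_trans (leeDl _ _).
    by rewrite lte_fin mulr_gt0// normr_gt0 gt_eqF.
  exact: nneseries_ge0.
move=> X CX; have [M [M0 XM]] := Linf_ae_bounded X.
(* A version of X + M that is nonnegative everywhere. *)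
pose h w := Num.max 0 (X w + M).
have mh : measurable_fun setT h.
  by apply: measurable_maxr => //; exact: measurable_funD.
have h0 w : 0 <= h w by rewrite le_max lexx.
have hE : \forall w \ae P, h w = X w + M.
  apply: filterS XM => w; rewrite ler_norml => /andP[+ _].
  by rewrite -subr_ge0 opprK => /max_idPr.
have hM : \forall w \ae P, `|h w| <= M + M.
  apply: filterS2 hE XM => w -> Xw.
  by rewrite (le_trans (ler_normD _ _))// lerD// ger0_norm.
have term n : (\int[P]_w ((h w)%:E * b n w) <= M%:E * (\int[P]_w b n w))%E.
  rewrite intb -EFinM.
  have -> : (\int[P]_w ((h w)%:E * b n w) =
      (c n * (dual_pairing X (g_ n) + M * I n))%:E)%E.
    have ihg : P.-integrable setT (EFin \o (fun w => h w * `|g_ n w|)).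
      exact: integrable_ae_boundedM hM _.
    transitivity (\int[P]_w ((c n)%:E * (h w * `|g_ n w|)%:E))%E.
      by apply: eq_integral => w _; rewrite /b -!EFinM mulrCA.
    rewrite integralZl// [RHS]EFinM; congr (_ * _)%E.
    rewrite -(fineK (integrable_fin_num measurableT ihg)); congr EFin.
    rewrite -[LHS]/(\int[P]_w (h w * `|g_ n w|)) /dual_pairing -RintegralZl//.
    rewrite -RintegralD//; last 2 first.
    - exact: dual_pairing_integrable.
    - exact: (integrableZl measurableT M (ing n)).
    apply: ae_eq_Rintegral.
    + exact: measurable_funM.
    + apply: measurable_funD; last exact: measurable_funM.
      exact: measurable_funM.
    + apply: filterS2 hE (polar_cone_ge0 (Cg n)) => w -> gn.
      by rewrite ger0_norm// mulrDl.
  rewrite lee_fin [leRHS]mulrCA (ler_wpM2l (ltW (c0 n)))// gerDr; exact: Cg.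
have : (\int[P]_w ((h w)%:E * G w) <= M%:E * \int[P]_w G w)%E.
  under eq_integral do rewrite /G -nneseriesZl//.
  rewrite integral_nneseries//; last 2 first.
  - by move=> n; apply: emeasurable_funM => //; exact/measurable_EFinP.
  - by move=> n w _; rewrite mule_ge0// lee_fin.
  rewrite intG -nneseriesZl//; last by move=> n _; rewrite lee_fin mulr_ge0// ltW.
  apply: lee_nneseries => [n _ _|n _]; last by rewrite -intb; exact: term.
  by apply: integral_ge0 => w _; rewrite mule_ge0// lee_fin.
have -> : (\int[P]_w ((h w)%:E * G w))%E =
    (dual_pairing X g + M * \int[P]_w g w)%:E.
  rewrite /dual_pairing -RintegralZl//; last exact: L1_integrable.
  have iXg := dual_pairing_integrable X g.
  have iMg : P.-integrable setT (EFin \o (fun w => M * g w)).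
    exact: (integrableZl measurableT M (L1_integrable g)).
  rewrite -RintegralD// fineK; last first.
    exact: (integrable_fin_num measurableT (integrableD measurableT iXg iMg)).
  apply: ae_eq_integral => //.
  - by apply: emeasurable_funM => //; exact/measurable_EFinP.
  - apply/measurable_EFinP; apply: measurable_funD; exact: measurable_funM.
  - apply: filterS2 hE Gfin => w hw Gw _; rewrite -Gw hw gE -EFinM.
    by rewrite mulrDl.
have -> : (\int[P]_w G w)%E = (\int[P]_w g w)%:E.
  rewrite /Rintegral fineK; last first.
    exact: (integrable_fin_num measurableT (L1_integrable g)).
  apply: ae_eq_integral => //; first exact/measurable_EFinP.
  by apply: filterS Gfin => w Gw _; rewrite -Gw gE.
by rewrite -EFinM lee_fin gerDr.
Qed.

(** Exhaustion: by [polar_cone_countable] the supremum of the probabilities of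
    the supports {g > 0} is attained by some g in the polar cone.  If A = {g <= 0}
    were not negligible, 1_A would not be in the closure of C, and adding to g an
    element of the polar cone separating 1_A from C would enlarge the support. *)
Lemma kreps_yan : weak_star_closure C `&` Linf_ge0 P `<=` Linf_zero P ->
  exists2 g, polar_cone C g & \forall w \ae P, 0 < g w.
Proof.
move=> Cfree.
pose supp (g : L1 P) := [set w | 0 < g w].
have msupp g : measurable (supp g).
  rewrite -[supp g]setTI.
  by apply: (@measurable_fun_ltr _ _ _ setT (cst 0) g).
pose S := [set fine (P (supp g)) | g in polar_cone C].
have S0 : S !=set0.
  exists (fine (P (supp 0))); exists 0 => // X _.
  by rewrite -(scale0r 0) dual_pairingZr mul0r.
have Sle1 : ubound S 1.
  by move=> _ [g _ <-]; rewrite -lee_fin fineK ?fin_num_measure// probability_le1.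
have supS : has_sup S by split => //; exists 1.
have /choice[g_ gS] : forall n : nat, exists g,
    polar_cone C g /\ sup S - n.+1%:R^-1 < fine (P (supp g)).
  move=> n; have [|_ [g Cg <-] lt_g] := @sup_adherent _ S n.+1%:R^-1 _ supS.
    by rewrite invr_gt0.
  by exists g.
have [g Cg gpos] := polar_cone_countable (fun n => (gS n).1).
have supg : sup S <= fine (P (supp g)).
  apply/ler_addgt0Pl => e e0.
  have [n _ /(_ n (leqnn n)) /= ne] := near_infty_natSinv_lt (PosNum e0).
  have := (gS n).2; rewrite ltrBlDl => /ltW /le_trans; apply.
  rewrite lerD ?(ltW ne)// fine_le ?fin_num_measure//.
  by apply: le_measure_ae => //; exact: gpos.
exists g => //.
have [//|gN] := pselect (\forall w \ae P, 0 < g w).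
pose A := ~` supp g.
have mA : measurable A by exact: measurableC.
have PA0 : P A != 0%E.
  apply/eqP => PA; apply: gN; exists A; split => //.
have [X XE] : exists X : Linf P, X = \1_A :> (T -> R).
  apply: (@Linf_of_ae_bounded _ _ _ P _ 1) => //.
  by apply: aeW => w; rewrite indicE; case: (_ \in _); rewrite ?normr1 ?normr0.
have [g' Cg' Xg'] : exists2 g', polar_cone C g' & 0 < dual_pairing X g'.
  apply: polar_cone_separates => [|clX]; first exact/Cneg/aeW.
   apply/negP: PA0; rewrite negbK.
  have : Linf_zero P X.
    by apply: Cfree; split => //; apply: aeW => w; rewrite XE indicE.
  move=> [N [mN PN XN]]; rewrite -measure_le0 -PN le_measure ?inE//.
  move=> w Aw; apply: XN => /=; rewrite XE indicE mem_set//.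
  by apply/eqP; rewrite oner_neq0.
pose B := A `&` supp g'.
have mB : measurable B by exact: measurableI.
have PB : P B != 0%E.
  apply/eqP => PB; move: Xg'; apply/negP; rewrite -leNgt.
  rewrite /dual_pairing (_ : 0 = \int[P]_w (cst 0 w)); last first.
    by rewrite Rintegral_cst// mul0r.
  apply: ae_le_Rintegral; [exact: dual_pairing_integrable| |].
    exact: finite_measure_integrable_cst.
  exists B; split => // w /=; rewrite XE indicE => /negP; rewrite -ltNge.
  have [|] := boolP (w \in A); last by rewrite mul0r ltxx.
  by rewrite inE mul1r => Aw gw; split.
have : fine (P (supp (g + g'))) <= sup S.
  by apply: sup_upper_bound => //; exists (g + g') => //; exact: polar_coneD.
apply: contraPP => _; apply/negP; rewrite -ltNge.
apply: le_lt_trans supg _; apply: (@lt_le_trans _ _ (fine (P (supp g `|` B)))).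
  rewrite measureU//; last by apply/disjoints_subset => w sgw [].
  rewrite fineD ?fin_num_measure// ltrDl fine_gt0//.
  by rewrite lt0e PB measure_ge0/= ltey_eq fin_num_measure.
have msB : measurable (supp g `|` B) by exact: measurableU.
rewrite fine_le ?fin_num_measure//; apply: le_measure_ae => //.
apply: filterS2 (polar_cone_ge0 Cg) (polar_cone_ge0 Cg') => w gw g'w [|[_]] /= sw.
  exact: ltr_pwDl.
exact: ltr_pwDr.
Qed.

End convex_cone.
End kreps_yan.

(** * Equivalent probabilities and densities *)

Section densities.
Context {d : measure_display} {T : measurableType d} {R : realType}.
Variable P : probability T R.

Lemma Rintegral_indicM (mu : {measure set T -> \bar R}) (A : set T) (f : T -> R) :
  \int[mu]_w (\1_A w * f w) = \int[mu]_(w in A) f w.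
Proof.
rewrite [RHS]Rintegral_mkcond; apply: eq_Rintegral => w _.
by rewrite indicE patchE; case: ifPn; rewrite ?mul1r ?mul0r.
Qed.

Lemma density_dominates (Q : probability T R) (h : T -> R) :
  measurable_fun setT h ->
  (forall A, measurable A -> Q A = \int[P]_(w in A) (h w)%:E)%E -> Q `<< P.
Proof.
move=> mh Qh; apply/null_content_dominatesP => A mA PA.
rewrite Qh//; apply: null_set_integral => //.
by apply/measurable_EFinP; exact: measurable_funTS.
Qed.

Lemma Rintegral_density (Q : probability T R) (h : L1 P) (X : T -> R) :
  (forall A, measurable A -> Q A = \int[P]_(w in A) (h w)%:E)%E ->
  Q.-integrable setT (EFin \o X) ->
  \int[Q]_w X w = \int[P]_w (X w * h w).
Proof.
move=> Qh iX.
have QP : Q `<< P by apply: density_dominates Qh.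
have mX := measurable_int _ iX.
rewrite /Rintegral -(Radon_Nikodym_change_of_variables QP measurableT iX).
congr fine; apply: ae_eq_integral => //.
- exact: emeasurable_funM.
- by apply/measurable_EFinP; apply: measurable_funM => //; exact/measurable_EFinP.
have : ae_eq P setT (Radon_Nikodym (charge_of_finite_measure Q) P) (EFin \o h).
  apply: (integral_ae_eq measurableT).
  - exact: Radon_Nikodym_integrable.
  - exact/measurable_EFinP.
  by move=> A _ mA; rewrite -Radon_Nikodym_integral// -Qh.
by apply: filterS => w + _ => /(_ I) ->; rewrite EFinM.
Qed.

Lemma dominated_density (Q : probability T R) : Q `<< P ->
  exists h : L1 P,
    (forall A, measurable A -> Q A = \int[P]_(w in A) (h w)%:E)%E.
Proof.
move=> QP; pose f := Radon_Nikodym (charge_of_finite_measure Q) P.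
have fE w : (fine (f w))%:E = f w by rewrite fineK// Radon_Nikodym_fin_num.
have fi : P.-integrable setT (EFin \o (fine \o f)).
  rewrite (_ : _ \o _ = f); first exact: Radon_Nikodym_integrable.
  by apply/funext => w /=.
have [h hE] := L1_of_integrable fi; exists h => A mA.
rewrite [LHS](_ : _ = charge_of_finite_measure Q A)//.
rewrite (@Radon_Nikodym_integral _ _ _ (charge_of_finite_measure Q) P A QP mA).
by apply: eq_integral => w _; rewrite hE /= fE.
Qed.

Lemma probability_of_density (g : L1 P) : (\forall w \ae P, 0 < g w) ->
  exists (Q : probability T R) (c : R), [/\ 0 < c, equivalent_measure Q P &
    forall A, measurable A -> (Q A = \int[P]_(w in A) (c * g w)%:E)%E].
Proof.
move=> g0.
have mg : measurable_fun setT (EFin \o g) by exact/measurable_EFinP.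
have ig := L1_integrable g.
have iag : P.-integrable setT (abse \o (EFin \o g)) by exact: integrable_abse.
have nu0 A : (0 <= induced_charge iag A)%E 
  by apply: integral_ge0 => w _; exact: abse_ge0.
(* The absolute value only matters on a negligible set; it makes mu a measure. *)
pose mu := measure_of_charge (induced_charge iag) nu0.
have muE A : measurable A -> (mu A = \int[P]_(w in A) (g w)%:E)%E.
  move=> mA; rewrite [LHS](_ : _ = \int[P]_(w in A) `|(g w)%:E|)%E//.
  apply: ae_eq_integral => //.
  - by apply: measurable_funTS; exact: measurableT_comp.
  - exact: measurable_funTS.
  - by apply: filterS g0 => w gw _; rewrite gee0_abs// lee_fin ltW.
have mu_eq0 A : measurable A -> mu A = 0%E -> P A = 0%E.
  move=> mA muA.
  have mA' := @measurable_funTS _ _ _ _ A _ mg.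
  have /(_ muA) := (ae_eq_integral_abs P mA mA').1.
  move=> gA.
  have [N [mN PN NA]] : \forall w \ae P, ~ A w.
    apply: filterS2 gA g0 => w + gw => /[apply] -[] gw0.
    by rewrite gw0 ltxx in gw.
  apply/eqP; rewrite -measure_le0 -PN le_measure ?inE//.
  by move=> w Aw; apply: NA => /=; exact.
have muT : mu setT \is a fin_num.
  by rewrite muE//; exact: integrable_fin_num.
have muT0 : mu setT != 0%E.
  apply/eqP => /(mu_eq0 _ measurableT); rewrite probability_setT => /eqP.
  by rewrite onee_eq0.
pose Q : probability T R := mnormalize mu P.
pose c := (fine (mu setT))^-1.
have c0 : 0 < c.
  by rewrite invr_gt0 fine_gt0// lt0e muT0 measure_ge0/= ltey_eq muT.
have QE A : Q A = (mu A * c%:E)%E.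
  rewrite /Q /= /mnormalize /= (negbTE muT0) /=.
  by case: eqP => // muTy; move: muT; rewrite fin_numE => /andP[_ /eqP[]].
have Qd A : measurable A -> (Q A = \int[P]_(w in A) (c * g w)%:E)%E.
  move=> mA; rewrite QE muE// muleC -integralZl//.
  exact: integrableS ig.
exists Q, c; split => //.
split.
  apply: density_dominates Qd; exact: measurable_funM.
apply/null_content_dominatesP => A mA QA0.
have /eqP : (mu A * c%:E)%E = 0%E by rewrite -QE.
rewrite mule_eq0 => /orP[/eqP|]; first exact: mu_eq0.
by rewrite eqe gt_eqF.
Qed.

End densities.

(** * Sub-sigma-algebras and conditional expectations *)

Section sub_sigma_algebra.
Context {d : measure_display} {T : measurableType d} {R : realType}.
Variable G : set_system T.
Hypothesis sG : sigma_algebra setT G.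

Lemma g_sigma_measurableE (A : set T) : G.-sigma.-measurable A = G A.
Proof. by rewrite measurable_g_measurableTypeE. Qed.

Lemma measurable_preimageP (f : T -> R) :
  (forall B, measurable B -> G (f @^-1` B)) <->
  measurable_fun setT (f : g_sigma_algebraType G -> R).
Proof.
split => [Gf _ B mB|mf B mB].
  by rewrite setTI g_sigma_measurableE; exact: Gf.
by rewrite -g_sigma_measurableE -[X in _ X]setTI; exact: mf.
Qed.

Hypothesis GT : G `<=` measurable.

Lemma measurable_fun_sub_sigma (f : T -> R) :
  measurable_fun setT (f : g_sigma_algebraType G -> R) -> measurable_fun setT f.
Proof.
by move=> /measurable_preimageP Gf _ B mB; rewrite setTI; exact: GT (Gf B mB).
Qed.

End sub_sigma_algebra.

Section conditional_expectation_existence.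
Context {d : measure_display} {T : measurableType d} {R : realType}.
Variables (Q : probability T R) (G : set_system T).
Hypotheses (sG : sigma_algebra setT G) (GT : G `<=` measurable).

(** Radon-Nikodym on the measurable space (T, G): both Q and the charge
    A |-> E_Q(X 1_A) are transported there by the identity of T. *)
Lemma cond_exp_exists (X : T -> R) :
  Q.-integrable setT (EFin \o X) -> exists Y, is_cond_exp Q G X Y.
Proof.
move=> iX.
have mid : measurable_fun setT (id : T -> g_sigma_algebraType G).
  by move=> _ B; rewrite setTI (g_sigma_measurableE sG); exact: GT.
pose i : {mfun T >-> g_sigma_algebraType G} := mfun_Sub (mem_set mid).
pose Q' : probability (g_sigma_algebraType G) R := distribution Q i.
have [nu nuE] : exists nu : {charge set (g_sigma_algebraType G) -> \bar R},
    forall A, nu A = (\int[Q]_(w in A) (X w)%:E)%E.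
  unshelve eexists.
    unshelve refine (pushforward (induced_charge iX) i : {charge set _ -> \bar R}).
    exact: mid.
  by [].
have nuQ : nu `<< Q'.
  apply/null_content_dominatesP => A mA QA; rewrite nuE.
  have mA' : d.-measurable (A : set T).
    by move: mA; rewrite (g_sigma_measurableE sG); exact: GT.
  apply: null_set_integral => //.
  exact: measurable_funTS (measurable_int _ iX).
pose Y := fine \o Radon_Nikodym nu Q'.
have YE : EFin \o Y = Radon_Nikodym nu Q'.
  by apply/funext => w /=; rewrite fineK// Radon_Nikodym_fin_num.
have iY' : Q'.-integrable setT (EFin \o Y).
  by rewrite YE; exact: Radon_Nikodym_integrable.
have mY' := measurable_int _ iY'.
have mY : measurable_fun setT (Y : g_sigma_algebraType G -> R).
  exact/measurable_EFinP.
have iY : Q.-integrable setT (EFin \o Y).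
  apply/integrableP; split.
    by apply/measurable_EFinP; exact: (measurable_fun_sub_sigma sG GT mY).
  have /integrableP[_] := iY'; rewrite ge0_integral_distribution//.
  exact: measurableT_comp.
exists Y; split => //; first exact/(measurable_preimageP sG).
move=> A GA; rewrite -nuE (@Radon_Nikodym_integral _ _ _ nu Q')//; last first.
  by rewrite g_sigma_measurableE.
rewrite -YE integral_pushforward//.
- exact: (integrableS measurableT (GT GA)).
- by rewrite g_sigma_measurableE.
Qed.

Lemma cond_expP (X : T -> R) :
  Q.-integrable setT (EFin \o X) -> is_cond_exp Q G X (cond_exp Q G X).
Proof. by move=> /cond_exp_exists[Y XY]; exact: (xgetPex _ (ex_intro _ Y XY)). Qed.

Lemma is_cond_expN (X Y : T -> R) : Q.-integrable setT (EFin \o X) ->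
  is_cond_exp Q G X Y -> is_cond_exp Q G (fun w => - X w) (fun w => - Y w).
Proof.
move=> iX [mY iY XY]; split.
- apply/(measurable_preimageP sG); apply: measurableT_comp => //.
  exact/(measurable_preimageP sG).
- exact: (integrableN iY).
- move=> A GA; have mA := GT GA.
  have XYN (Z : T -> R) : Q.-integrable setT (EFin \o Z) ->
      (\int[Q]_(w in A) (- Z w)%:E = - \int[Q]_(w in A) (Z w)%:E)%E.
    move=> iZ; under eq_integral do rewrite EFinN.
    by apply: integralN; apply: integrable_add_def => //; exact: integrableS iZ.
  by rewrite !XYN// XY.
Qed.

End conditional_expectation_existence.

(** * Stopping times *)

Section stopping_times.
Context {d : measure_display} {T : measurableType d} {R : realType}.
Variables (P : probability T R) (F : R -> set_system T).
Hypothesis hF : filtered_probability_space P F.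

Lemma stopping_time_cst (c : \bar R) : (0 <= c)%E -> stopping_time F (cst c).
Proof.
move=> c0; split => // t t0.
have [F0 FC _] := filtration_sigma_algebra hF t0.
have [ct|ct] := boolP (c <= t%:E)%E.
  rewrite (_ : [set _ | _] = setT `\` set0); first exact: FC.
  by rewrite setD0; apply/seteqP; split.
by rewrite (_ : [set _ | _] = set0)//; apply/seteqP;
  split => // w /=; rewrite (negbTE ct).
Qed.

Lemma stopped_sigma_algebra_sub tau : stopped_sigma_algebra F tau `<=` measurable.
Proof. by move=> A []. Qed.

Lemma stopped_sigma_algebraP tau : stopping_time F tau ->
  sigma_algebra setT (stopped_sigma_algebra F tau).
Proof.
move=> [_ st]; split.
- split => // t t0; rewrite set0I.
  by have [] := filtration_sigma_algebra hF t0.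
- move=> A [mA FA]; split => [|t t0]; first by rewrite setTD; exact: measurableC.
  have sF := filtration_sigma_algebra hF t0.
  rewrite -(g_sigma_measurableE sF) setTD.
  rewrite (_ : _ `&` _ = [set w | (tau w <= t%:E)%E] `\`
      (A `&` [set w | (tau w <= t%:E)%E])); last first.
    apply/seteqP; split => w /=; first by case=> nA tw; split => // -[].
    by case=> tw nA; split => // Aw; apply: nA.
  by apply: measurableD; rewrite g_sigma_measurableE//; [exact: st|exact: FA].
- move=> A_ FA; split => [|t t0].
    by apply: bigcup_measurable => n _; have [] := FA n.
  have [_ _ Fbig] := filtration_sigma_algebra hF t0.
  by rewrite setI_bigcupl; apply: Fbig => n; have [_] := FA n; exact.
Qed.

Lemma Linf_on_stopped_infty (X : Linf P) :
  Linf_on (stopped_sigma_algebra F (cst +oo%E)) X.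
Proof.
move=> B mB; split => [|t t0].
  by rewrite -[X in measurable X]setTI; exact: measurable_funP.
rewrite (_ : _ `&` _ = set0); last by apply/seteqP; split => // w [].
by have [] := filtration_sigma_algebra hF t0.
Qed.

End stopping_times.

(** * Pricing maps *)

Section pricing_map_theory.
Context {d : measure_display} {T : measurableType d} {R : realType}.
Variables (P : probability T R) (G H : set_system T) (p : Linf P -> Linf P).
Hypothesis sG : sigma_algebra setT G.
Hypothesis GT : G `<=` measurable.
Hypothesis HT : forall X : Linf P, Linf_on H X.
Hypothesis hp : pricing_map G H p.

Lemma Linf_on_indic (A : set T) (M : R) : G A ->
  exists V : Linf P, V = (fun w => M * \1_A w) :> (T -> R) /\ Linf_on G V.
Proof.
move=> GA.
have mV : measurable_fun setT ((fun w => M * \1_A w) : g_sigma_algebraType G -> R).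
  apply: measurable_funM => //; apply: measurable_indic.
  by rewrite g_sigma_measurableE.
have [V VE] : exists V : Linf P, V = (fun w => M * \1_A w) :> (T -> R).
  apply: (@Linf_of_ae_bounded _ _ _ P _ `|M|).
    exact: (measurable_fun_sub_sigma sG GT mV).
  apply: aeW => w; rewrite normrM indicE.
  by case: (_ \in _); rewrite ?normr1 ?normr0 ?mulr1 ?mulr0.
by exists V; split => //; rewrite /Linf_on /= VE; apply/(measurable_preimageP sG).
Qed.

Lemma Linf_onN (X : Linf P) : Linf_on G X -> Linf_on G (- X).
Proof.
move=> /(measurable_preimageP sG) mX; apply/(measurable_preimageP sG).
exact: measurableT_comp.
Qed.

(** Let Z = X - p(X), so that p(Z) = 0, and let M bound |Z|.  Then W = 1_A Z is
    below M 1_A and below Z + M 1_{~A}; by monotonicity and translation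
    invariance p(W) is below M 1_A and below M 1_{~A}, and at each point one of
    these two bounds is 0. *)
Lemma pricing_local (A : set T) (X W : Linf P) : G A ->
  (forall w, W w = \1_A w * (X w - p X w)) -> \forall w \ae P, p W w <= 0.
Proof.
move=> GA WE; pose Z := X - p X.
have ZE w : Z w = X w - p X w by [].
have pZ0 : \forall w \ae P, p Z w = 0.
  have := pricing_translation hp (HT X) (Linf_onN (pricing_range hp (HT X))).
  by apply: filterS => w ->; rewrite /= subrr.
have [M [M0 ZM]] := Linf_ae_bounded Z.
have GcA : G (~` A).
  by rewrite -(g_sigma_measurableE sG); apply: measurableC; rewrite g_sigma_measurableE.
have [V [VE GV]] := Linf_on_indic M GA.
have [V' [V'E GV']] := Linf_on_indic M GcA.
have pW1 : \forall w \ae P, p W w <= V w.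
  have h : \forall w \ae P, W w <= (0 + V) w.
    apply: filterS ZM => w; rewrite /= WE -ZE add0r VE => Zw.
    rewrite indicE; case: (_ \in _); last by rewrite mul0r mulr0.
    by rewrite mul1r mulr1; exact: le_trans (ler_norm _) Zw.
  have := pricing_monotone hp (HT _) (HT _) h.
  apply: filterS3 (pricing_translation hp (HT 0) GV) (pricing_normalized hp).
  by move=> w -> ->; rewrite add0r.
have pW2 : \forall w \ae P, p W w <= V' w.
  have h : \forall w \ae P, W w <= (Z + V') w.
    apply: filterS ZM => w; rewrite WE -ZE => Zw.
    have -> : (Z + V') w = Z w + V' w by [].
    rewrite V'E !indicE.
    have [Aw|nAw] := pselect (A w).
      by rewrite (mem_set Aw) (@memNset _ (~` A))/= ?mul1r ?mulr0 ?addr0//; exact.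
    rewrite (memNset nAw) (@mem_set _ (~` A))//=.
    rewrite mul0r mulr1 -lerBlDl sub0r; apply: le_trans Zw.
    by rewrite -normrN ler_norm.
  have := pricing_monotone hp (HT _) (HT _) h.
  apply: filterS3 (pricing_translation hp (HT Z) GV') pZ0.
  by move=> w -> ->; rewrite add0r.
apply: filterS2 pW1 pW2 => w; rewrite VE V'E !indicE.
have [Aw|nAw] := pselect (A w); last by rewrite (memNset nAw) mulr0.
by rewrite (@memNset _ (~` A)) ?mulr0//; exact.
Qed.

Lemma pricing_le0 (X : Linf P) : (\forall w \ae P, X w <= 0) ->
  \forall w \ae P, p X w <= 0.
Proof.
move=> X0; have := pricing_monotone hp (HT X) (HT 0) X0.
by apply: filterS2 (pricing_normalized hp) => w ->.
Qed.

End pricing_map_theory.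

(** * Probabilities supporting the prices *)

Section supporting_measures.
Context {d : measure_display} {T : measurableType d} {R : realType}.
Variables (P : probability T R) (F : R -> set_system T).
Variable Pi : (T -> \bar R) -> (T -> \bar R) -> Linf P -> Linf P.
Hypothesis hF : filtered_probability_space P F.
Hypothesis hPi : TCPP F Pi.

Local Notation "'F_[' tau ]" := (stopped_sigma_algebra F tau).
Local Notation Pi0 := (Pi (cst 0%E) (cst +oo%E)).

(** By translation invariance this amounts to E_Q <= Pi_{0,oo} on L^oo, that is,
    to a zero minimal penalty at time 0. *)
Definition supports (Q : probability T R) := forall X : Linf P,
  (\forall w \ae P, Pi0 X w <= 0) -> \int[Q]_w X w <= 0.

Lemma stopping_time0 : stopping_time F (cst 0%E).
Proof. exact: stopping_time_cst hF _ _. Qed.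

Lemma stopping_timey : stopping_time F (cst +oo%E).
Proof. exact: stopping_time_cst hF _ _. Qed.

Lemma pricing_to_infty sigma : stopping_time F sigma ->
  pricing_map F_[sigma] F_[cst +oo%E] (Pi sigma (cst +oo%E)).
Proof.
move=> st; have [dpp _ _] := hPi; apply: dpp => //; first exact: stopping_timey.
by move=> w; rewrite leey.
Qed.

Let HT (X : Linf P) : Linf_on F_[cst +oo%E] X.
Proof. exact: Linf_on_stopped_infty hF X. Qed.

(** Time consistency: Pi_{0,oo}(W) = Pi_{0,sigma}(Pi_{sigma,oo}(W)). *)
Lemma pricing_at0_le0 (sigma : T -> \bar R) (W : Linf P) : stopping_time F sigma ->
  (\forall w \ae P, Pi sigma (cst +oo%E) W w <= 0) ->
  \forall w \ae P, Pi0 W w <= 0.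
Proof.
move=> st W0; have [dpp tc _] := hPi.
have s0 w : (0 <= sigma w)%E by case: st.
have hp := dpp _ _ stopping_time0 st s0.
have r1 : Linf_on F_[sigma] (Pi sigma (cst +oo%E) W).
  exact: (pricing_range (pricing_to_infty st) (HT W)).
have r0 : Linf_on F_[sigma] (0 : Linf P).
  apply/(measurable_preimageP (stopped_sigma_algebraP hF st)).
  exact: measurable_cst.
have := tc _ _ _ stopping_time0 st stopping_timey s0 (fun w => leey _) W (HT W).
have := pricing_monotone hp r1 r0 W0.
by apply: filterS3 (pricing_normalized hp) => w -> + <-.
Qed.

(** The claim W of [pricing_local], for the event A where the inequality fails, has
    E_Q(W) <= 0, although it has the same Q-expectation as the nonnegative
    1_A (Y - Pi_sigma(X)), which is positive on A. *)
Lemma supports_cond_exp_le (Q : probability T R) (sigma : T -> \bar R)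
    (X : Linf P) (Y : T -> R) :
  equivalent_measure Q P -> supports Q -> stopping_time F sigma ->
  is_cond_exp Q F_[sigma] X Y ->
  \forall w \ae P, Y w <= Pi sigma (cst +oo%E) X w.
Proof.
move=> [QP PQ] sQ st [GY iY XY].
have sG := stopped_sigma_algebraP hF st.
have GT := @stopped_sigma_algebra_sub _ T _ F sigma.
have hp := pricing_to_infty st.
set p := Pi sigma (cst +oo%E) in hp *.
pose A := [set w | p X w < Y w].
have GA : F_[sigma] A.
  rewrite -(g_sigma_measurableE sG) -[A]setTI.
  apply: (@measurable_fun_ltr _ (g_sigma_algebraType F_[sigma]) R setT (p X) Y) => //.
    exact/(measurable_preimageP sG)/(pricing_range hp (HT X)).
  exact/(measurable_preimageP sG).
have mA : measurable A by exact: GT.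
have [M [M0 ZM]] := Linf_ae_bounded (X - p X).
have [W WE] : exists W : Linf P, W = (fun w => \1_A w * (X w - p X w)) :> (T -> R).
  apply: (@Linf_of_ae_bounded _ _ _ P _ M).
    by apply: measurable_funM => //; exact: measurable_funB.
  apply: filterS ZM => w; rewrite normrM indicE.
  by case: (_ \in _); rewrite ?normr1 ?normr0 ?mul1r ?mul0r.
have pW0 : \forall w \ae P, p W w <= 0.
  by apply: (pricing_local sG GT HT hp GA (X := X)) => w; rewrite WE.
have := sQ W (pricing_at0_le0 st pW0).
rewrite WE Rintegral_indicM.
have iX := integrableS measurableT mA (@subsetT _ _) (Linf_integrable X QP).
have ip := integrableS measurableT mA (@subsetT _ _) (Linf_integrable (p X) QP).
have iYA := integrableS measurableT mA (@subsetT _ _) iY.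
rewrite RintegralB// [X in X - _]/Rintegral -XY// -/(Rintegral _ _ _).
rewrite -RintegralB// -Rintegral_indicM => Yp.
have i1 : Q.-integrable setT (EFin \o (fun w => \1_A w * (Y w - p X w))).
  apply: (@integrable_ae_boundedM _ _ _ Q 1) => //.
  - by apply: aeW => w; rewrite indicE; case: (_ \in _); rewrite ?normr1 ?normr0.
  - exact: (integrableB measurableT iY (Linf_integrable (p X) QP)).
have pos : \forall w \ae Q, 0 <= \1_A w * (Y w - p X w).
  apply: aeW => w; rewrite indicE; have [|_] := boolP (w \in A).
    by rewrite inE mul1r subr_ge0 => /ltW.
  by rewrite mul0r.
apply: (dominates_ae PQ); apply: filterS (Rintegral_le0_ae_eq0 i1 pos Yp) => w.
rewrite indicE leNgt => /eqP Y0; apply/negP => Aw; move: Y0.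
by rewrite mem_set// mul1r subr_eq0 gt_eqF.
Qed.

Lemma supports_cond_exp_ge (Q : probability T R) (sigma : T -> \bar R)
    (X : Linf P) (Y : T -> R) :
  equivalent_measure Q P -> supports Q -> stopping_time F sigma ->
  is_cond_exp Q F_[sigma] X Y ->
  \forall w \ae P, - Pi sigma (cst +oo%E) (- X) w <= Y w.
Proof.
move=> QP sQ st XY.
have NXY : is_cond_exp Q F_[sigma] (- X) (fun w => - Y w).
  apply: (is_cond_expN (stopped_sigma_algebraP hF st)) XY.
    exact: stopped_sigma_algebra_sub.
  by apply: Linf_integrable; case: QP.
have := supports_cond_exp_le QP sQ st NXY.
by apply: filterS => w; rewrite lerNl.
Qed.

End supporting_measures.

(** * The equivalences *)

Section equivalences.
Context {d : measure_display} {T : measurableType d} {R : realType}.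
Variables (P : probability T R) (F : R -> set_system T).
Variable Pi : (T -> \bar R) -> (T -> \bar R) -> Linf P -> Linf P.
Hypothesis hF : filtered_probability_space P F.
Hypothesis hPi : TCPP F Pi.

Local Notation "'F_[' tau ]" := (stopped_sigma_algebra F tau).
Local Notation Pi0 := (Pi (cst 0%E) (cst +oo%E)).

Let HT (X : Linf P) : Linf_on F_[cst +oo%E] X.
Proof. exact: Linf_on_stopped_infty hF X. Qed.

Let hp0 : pricing_map F_[cst 0%E] F_[cst +oo%E] Pi0.
Proof. exact: (pricing_to_infty hF hPi (stopping_time0 hF)). Qed.

Let le0_static (X : Linf P) :
  (\forall w \ae P, X w <= 0) -> static_free_lunches Pi X.
Proof.
move=> X0; exists 1; first exact: ler01.
by exists X; [exact: (pricing_le0 HT hp0 X0)|rewrite scale1r].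
Qed.

Lemma static_free_lunchesD (X Y : Linf P) : static_free_lunches Pi X ->
  static_free_lunches Pi Y -> static_free_lunches Pi (X + Y).
Proof.
move=> [l /= l0 [X' X0 <-]] [m /= m0 [Y' Y0 <-]].
have [lm0|lm] := eqVneq (l + m) 0.
  have [l00 m00] : l = 0 /\ m = 0 by split; lra.
  apply: le0_static; rewrite l00 m00 !scale0r addr0.
  exact: aeW.
have lm_gt0 : 0 < l + m by rewrite lt_neqAle eq_sym lm addr_ge0.
exists (l + m); first exact: ltW.
pose t := l / (l + m).
have t01 : 0 <= t <= 1.
  by rewrite divr_ge0 ?addr_ge0//= ler_pdivrMr// mul1r lerDl.
have tE : 1 - t = m / (l + m) by rewrite /t; field.
exists (t *: X' + (1 - t) *: Y'); last first.
  by rewrite scalerDr !scalerA tE /t !(mulrC (l + m)) !divfK.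
apply: filterS3 (pricing_convex hp0 (HT X') (HT Y') t01) X0 Y0 => w /= h x0 y0.
have /andP[t0 t1] := t01.
rewrite (le_trans h)// -[leRHS]addr0 lerD//.
  exact: mulr_ge0_le0.
by apply: mulr_ge0_le0 => //; rewrite subr_ge0.
Qed.

Lemma static_free_lunchesZ a (X : Linf P) : 0 <= a -> static_free_lunches Pi X ->
  static_free_lunches Pi (a *: X).
Proof.
move=> a0 [l /= l0 [X' X0 <-]]; exists (a * l); first exact: mulr_ge0.
by exists X' => //; rewrite scalerA.
Qed.

Lemma no_static_free_lunch_supports : no_static_free_lunch Pi ->
  exists2 Q : probability T R, equivalent_measure Q P & supports Pi Q.
Proof.
move=> nsfl.
have [||||g gC g0] := @kreps_yan _ _ _ P (static_free_lunches Pi).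
- exact: static_free_lunchesD.
- exact: static_free_lunchesZ.
- exact: le0_static.
- by rewrite -[X in _ `<=` X]nsfl.
have [Q [c [c0 QP Qd]]] := probability_of_density g0.
exists Q => // X X0.
have iX : Q.-integrable setT (EFin \o X) by apply: Linf_integrable; case: QP.
rewrite (Rintegral_density (h := c *: g) Qd iX).
rewrite -/(dual_pairing X (c *: g)) dual_pairingZr pmulr_rle0//.
by apply: gC; exists 1; [exact: ler01|exists X; rewrite ?scale1r].
Qed.

(** The bound 0 is [supports_cond_exp_le] at time 0; it is attained at X = 0. *)
Lemma zero_is_ess_sup (Q : probability T R) :
  equivalent_measure Q P -> supports Pi Q ->
  is_ess_sup Q [set (fun w => cond_exp Q F_[cst 0%E] X w - Pi0 X w)
    | X in Linf_on F_[cst +oo%E]] (cst 0%E).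
Proof.
move=> QP sQ; have [QP1 PQ] := QP.
have st0 := stopping_time0 hF.
have sG := stopped_sigma_algebraP hF st0.
have cP (X : Linf P) : is_cond_exp Q F_[cst 0%E] X (cond_exp Q F_[cst 0%E] X).
  apply: (cond_expP sG); first exact: stopped_sigma_algebra_sub.
  exact: Linf_integrable.
split => //.
- move=> _ [X _ <-]; apply: (dominates_ae QP1).
  apply: filterS (supports_cond_exp_le hF hPi QP sQ st0 (cP X)) => w.
  by rewrite lee_fin subr_le0.
- move=> b mb bub.
  have h := bub _ (ex_intro2 _ _ (0 : Linf P) (HT _) erefl).
  have p0 := dominates_ae QP1 (pricing_normalized hp0).
  have := dominates_ae QP1 (supports_cond_exp_ge hF hPi QP sQ st0 (cP 0)).
  rewrite oppr0; apply: filterS3 h p0 => w hb p0w.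
  by rewrite p0w oppr0 => ge0; apply: le_trans hb; rewrite lee_fin p0w subr0.
Qed.

Lemma supports_minimal_penalty (Q : probability T R) :
  equivalent_measure Q P -> supports Pi Q ->
  \forall w \ae Q, minimal_penalty F Pi (cst 0%E) (cst +oo%E) Q w = 0%E.
Proof.
move=> QP sQ; have z := zero_is_ess_sup QP sQ.
have := xgetPex (cst +oo%E) (ex_intro _ _ z) : is_ess_sup _ _ _.
rewrite -/(family_ess_sup _ _) => -[ma aub aleast].
have h1 := aleast _ (ess_sup_measurable z) (ess_sup_ub z).
have h2 := ess_sup_least z ma aub.
by apply: filterS2 h1 h2 => w h1 h2; apply/eqP; rewrite eq_le; apply/andP.
Qed.

(** A penalty equal to 0 differs from the default value +oo, so it is an actual
    essential supremum and bounds E_Q(X | F_0) - Pi_{0,oo}(X) for every X. *)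
Lemma minimal_penalty_supports (Q : probability T R) : equivalent_measure Q P ->
  (\forall w \ae Q, minimal_penalty F Pi (cst 0%E) (cst +oo%E) Q w = 0%E) ->
  supports Pi Q.
Proof.
move=> [QP PQ]; rewrite /minimal_penalty /family_ess_sup.
set S := [set _ | X in _].
have [eS|nS] := pselect (exists a, is_ess_sup Q S a); last first.
  rewrite xgetPN => [ynul|a Sa]; last by apply: nS; exists a.
  have : \forall w \ae Q, False by apply: filterS ynul.
  move=> [N [mN QN NT]]; have : Q setT = 0%E.
    by apply/eqP; rewrite -measure_le0 -QN le_measure ?inE// => w _; apply: NT.
  by rewrite probability_setT => /eqP; rewrite onee_eq0.
have /= := xgetPex (cst +oo%E) eS.
move: (xget _ _) => a [_ aub _] a0 X X0.
have st0 := stopping_time0 hF.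
have sG := stopped_sigma_algebraP hF st0.
have iX := Linf_integrable X QP.
have [_ iY XY] := cond_expP sG (@stopped_sigma_algebra_sub _ T _ F _) iX.
have GT : F_[cst 0%E] setT.
  by rewrite -(g_sigma_measurableE sG); exact: measurableT.
rewrite /Rintegral -XY// -/(Rintegral _ _ _).
have -> : 0 = \int[Q]_w (cst 0 w) by rewrite Rintegral_cst// mul0r.
apply: ae_le_Rintegral => //; first exact: finite_measure_integrable_cst.
have Xub := aub _ (ex_intro2 _ _ X (HT X) erefl).
apply: filterS3 Xub a0 (dominates_ae QP X0) => w Xa aw px.
by move: Xa; rewrite aw lee_fin subr_le0 => /le_trans; apply.
Qed.

Lemma sub_closure_cone_hull (A : set (Linf P)) (X : Linf P) :
  A X -> weak_star_closure (cone_hull A) X.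
Proof.
move=> AX; apply: subset_closure; exists 1; first exact: ler01.
by exists X => //; rewrite scale1r.
Qed.

Lemma static_multiperiod (X : Linf P) : (\forall w \ae P, Pi0 X w <= 0) ->
  multiperiod_portfolios F Pi X.
Proof.
move=> X0; exists 0, (fun i => cst 0%E), X, (fun=> 0), (fun=> 0); split => //.
- by split => [[]|[]|[]].
- by case.
- by rewrite big_ord0 addr0.
Qed.

Let zero_le0 (X : Linf P) : Linf_zero P X -> \forall w \ae P, Pi0 X w <= 0.
Proof.
move=> X0; apply: (pricing_le0 HT hp0).
by apply: filterS X0 => w ->.
Qed.

Let zero_ge0 (X : Linf P) : Linf_zero P X -> Linf_ge0 P X.
Proof. by apply: filterS => w ->. Qed.

Lemma multiperiod_static :
  no_multiperiod_free_lunch F Pi -> no_static_free_lunch Pi.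
Proof.
move=> nmfl; apply/seteqP; split => [X [clX X0]|X X0]; last first.
  by split; [apply: sub_closure_cone_hull; exact: zero_le0|exact: zero_ge0].
rewrite -nmfl; split => //; apply: closureS clX => _ [l l0 [Y Y0 <-]].
by exists l => //; exists Y => //; exact: static_multiperiod.
Qed.

(** For a trade, Pi_tau(Z) <= - Pi_tau(- Y) and the two-sided bound on the
    conditional expectations give E_Q(Z | F_tau) <= E_Q(Y | F_tau).  Hence the
    portfolios lie in the weak* closed half-space E_Q <= 0. *)
Lemma consistent_measure_no_free_lunch (Q : probability T R) :
  equivalent_measure Q P ->
  (forall sigma : T -> \bar R, stopping_time F sigma ->
    forall X : Linf P, \forall w \ae P,
      - Pi sigma (cst +oo%E) (- X) w
        <= cond_exp Q F_[sigma] X w <= Pi sigma (cst +oo%E) X w) ->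
  no_multiperiod_free_lunch F Pi.
Proof.
move=> [QP PQ] Qc.
have [h Qh] := dominated_density QP.
have QE (X : Linf P) : dual_pairing X h = \int[Q]_w X w.
  by rewrite (Rintegral_density Qh)//; exact: Linf_integrable.
have cE sigma (X : Linf P) : stopping_time F sigma ->
    Q.-integrable setT (EFin \o cond_exp Q F_[sigma] X) /\
    \int[Q]_w X w = \int[Q]_w cond_exp Q F_[sigma] X w.
  move=> st; have sG := stopped_sigma_algebraP hF st.
  have [_ iY XY] := cond_expP sG (@stopped_sigma_algebra_sub _ T _ F _)
    (Linf_integrable X QP).
  have GT : F_[sigma] setT by rewrite -(g_sigma_measurableE sG); exact: measurableT.
  by split => //; rewrite /Rintegral -XY.
apply/seteqP; split => [X [clX X0]|X X0]; last first.
  split; last exact: zero_ge0.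
  by apply: sub_closure_cone_hull; apply: static_multiperiod; exact: zero_le0.
have Kle0 Y : cone_hull (multiperiod_portfolios F Pi) Y -> dual_pairing Y h <= 0.
  move=> [l /= l0 [_ [n [tau [X1 [Y1 [Z1 [[stau _ _] X10 ZY ->]]]]]] <-]].
  rewrite dual_pairingZl mulr_ge0_le0//.
  have -> : dual_pairing (X1 + \sum_(i < n) (Z1 i - Y1 i)) h =
      dual_pairing X1 h + \sum_(i < n) (dual_pairing (Z1 i) h - dual_pairing (Y1 i) h).
    rewrite dual_pairingDl; congr (_ + _).
    elim/big_ind2 : _ => [|_ a _ b <- <-|i _].
    - by rewrite -(scale0r 0) dual_pairingZl mul0r.
    - by rewrite dual_pairingDl.
    - by rewrite dual_pairingDl -scaleN1r dual_pairingZl mulN1r.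
  rewrite -[leRHS]addr0 lerD//.
    have [iX1 X1E] := cE _ X1 (stopping_time0 hF).
    rewrite QE X1E.
    have -> : 0 = \int[Q]_w (cst 0 w) by rewrite Rintegral_cst// mul0r.
    apply: ae_le_Rintegral => //; first exact: finite_measure_integrable_cst.
    apply: (dominates_ae QP).
    apply: filterS2 X10 (Qc _ (stopping_time0 hF) X1) => w x0 /andP[_ xw].
    exact: le_trans xw x0.
  apply: sumr_le0 => i _; rewrite subr_le0 !QE.
  have [iZ ->] := cE _ (Z1 i) (stau i); have [iY ->] := cE _ (Y1 i) (stau i).
  apply: ae_le_Rintegral => //; apply: (dominates_ae QP).
  apply: filterS3 (ZY i) (Qc _ (stau i) (Z1 i)) (Qc _ (stau i) (Y1 i)).
  by move=> w zy /andP[_ z] /andP[y _]; rewrite (le_trans z)// (le_trans zy).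
have := weak_star_closure_halfspace Kle0 clX; rewrite QE => IX.
apply: (dominates_ae PQ).
exact: Rintegral_le0_ae_eq0 (Linf_integrable X QP) (dominates_ae QP X0) IX.
Qed.

End equivalences.

Theorem theorem2p1 (R : realType) (d : measure_display) (T : measurableType d)
    (P : probability T R) (F : R -> set_system T)
    (hF : filtered_probability_space P F)
    (Pi : (T -> \bar R) -> (T -> \bar R) -> Linf P -> Linf P)
    (hPi : TCPP F Pi) :
  [<-> no_multiperiod_free_lunch F Pi ;
       no_static_free_lunch Pi ;
       exists Q : probability T R, equivalent_measure Q P /\
         (\forall w \ae Q, minimal_penalty F Pi (cst 0%E) (cst +oo%E) Q w = 0%E) ;
       exists Q : probability T R, equivalent_measure Q P /\
         forall sigma : T -> \bar R, stopping_time F sigma ->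
         forall X : Linf P, \forall w \ae P,
           - Pi sigma (cst +oo%E) (- X) w
             <= cond_exp Q (stopped_sigma_algebra F sigma) X w
             <= Pi sigma (cst +oo%E) X w ].
Proof.
tfae.
- exact: multiperiod_static.
- move=> /(no_static_free_lunch_supports hF hPi)[Q QP sQ].
  by exists Q; split => //; exact: supports_minimal_penalty.
- move=> [Q [QP /(minimal_penalty_supports hF QP) sQ]].
  exists Q; split => // sigma st X.
  have XY : is_cond_exp Q (stopped_sigma_algebra F sigma) X
      (cond_exp Q (stopped_sigma_algebra F sigma) X).
    apply: (cond_expP (stopped_sigma_algebraP hF st)).
      exact: stopped_sigma_algebra_sub.
    by apply: Linf_integrable; case: QP.
  apply: filterS2 (supports_cond_exp_ge hF hPi QP sQ st XY)
    (supports_cond_exp_le hF hPi QP sQ st XY) => w ge le.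
  by apply/andP.
- move=> [Q [QP Qc]]; exact: consistent_measure_no_free_lunch QP Qc.
Qed.
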